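(* Assume the Axiom of Choice. Let $X,Y$ be nonempty sets and let $F\colon X^*\to Y$ be a function. Consider the following assertions. (i) $F$ is preassociative and unarily quasi-range-idempotent. (ii) There exist an associative $\varepsilon$-standard operation $H\colon X^*\to X\cup\{\varepsilon\}$ and a one-to-one function $f\colon\mathrm{ran}(H^{\flat})\to Y$ such that $F^{\flat}=f\circ H^{\flat}$. Then (i) implies (ii). If $F$ is standard, then (ii) implies (i). Moreover, if condition (ii) holds, then $F^{\flat}=F_1\circ H^{\flat}$, $f=F_1|_{\mathrm{ran}(H^{\flat})}$, $f^{-1}\in Q(F_1)$ (for any $H,f$ as in (ii)), and we may choose $H^{\flat}=g\circ F^{\flat}$ for any $g\in Q(F_1)$ (that is, for every $g\in Q(F_1)$, the $\varepsilon$-standard operation $H$ with $H^{\flat}=g\circ F^{\flat}$ satisfies (ii) for some one-to-one $f$).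
   Context: $X^*=\bigcup_{n\geqslant 0}X^n$ is the set of all finite strings over $X$ (vectors in $X^n$ are regarded as strings of length $n$), with $X^0=\{\varepsilon\}$, where $\varepsilon$ is the empty string ($\varepsilon\notin X$). Concatenation is denoted by juxtaposition, and $\varepsilon$ is neutral for it. For a function $F$ on $X^*$, $F_n=F|_{X^n}$ and $F^{\flat}=F|_{X^*\setminus\{\varepsilon\}}$. $\mathrm{ran}$ and $\mathrm{dom}$ denote range and domain. A function $F\colon X^*\to Y$ is standard if $F(\mathbf{x})=F(\varepsilon)$ only if $\mathbf{x}=\varepsilon$. It is preassociative if for all $\mathbf{x},\mathbf{y},\mathbf{y}',\mathbf{z}\in X^*$, $F(\mathbf{y})=F(\mathbf{y}')$ implies $F(\mathbf{x}\mathbf{y}\mathbf{z})=F(\mathbf{x}\mathbf{y}'\mathbf{z})$. It is unarily quasi-range-idempotent if $\mathrm{ran}(F_1)=\mathrm{ran}(F^{\flat})$. An operation $H\colon X^*\to X\cup\{\varepsilon\}$ is $\varepsilon$-standard if $H(\varepsilon)=\varepsilon$ and $H(\mathbf{x})=\varepsilon$ only if $\mathbf{x}=\varepsilon$ (so $H^\flat$ takes values in $X$). It is associative if $H(\mathbf{x}\mathbf{y}\mathbf{z})=H(\mathbf{x}\,H(\mathbf{y})\,\mathbf{z})$ for all $\mathbf{x},\mathbf{y},\mathbf{z}\in X^*$, where $H(\mathbf{y})$ is regarded as a string of length at most one. $Q(f)$ is the set of quasi-inverses of a function $f$: a function $g$ (with $\mathrm{ran}(f)\subseteq\mathrm{dom}(g)$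 and $\mathrm{ran}(g)\subseteq\mathrm{dom}(f)$) is a quasi-inverse of $f$ if $f\circ g|_{\mathrm{ran}(f)}=\mathrm{id}|_{\mathrm{ran}(f)}$ and $\mathrm{ran}(g|_{\mathrm{ran}(f)})=\mathrm{ran}(g)$. The inverse $f^{-1}$ of a one-to-one function $f$ has domain $\mathrm{ran}(f)$. *)

(* Defs.v *)
From mathcomp Require Import all_boot.
From mathcomp Require Import boolp classical_sets.

Set Implicit Arguments.
Unset Strict Implicit.
Unset Printing Implicit Defensive.

Local Open Scope classical_set_scope.

(** A function whose domain is a subset of [A] is a map [A -> option B] with
    value [None] exactly outside the domain, so that Leibniz equality compares
    domains as well as values.  Composition is [pcomp] of ssrfun. *)
Section PartialFunctions.
Variables A B : Type.
Implicit Types f : A -> option B.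

Definition dom f : set A := [set x | exists y, f x = Some y].

Definition ran f : set B := [set y | exists x, f x = Some y].

Definition restr (D : set A) f : A -> option B :=
  fun x => if x \in D then f x else None.

Definition id_on (D : set A) : A -> option A :=
  fun x => if x \in D then Some x else None.

Definition one_to_one f : Prop := {in dom f &, injective f}.

(** Depends on the choice of preimages unless [f] is one-to-one. *)
Definition pinverse f : B -> option A := fun y =>
  if pselect (exists x, f x = Some y) is left ex then Some (projT1 (cid ex))
  else None.

End PartialFunctions.

Definition Q (A B : Type) (f : A -> option B) : set (B -> option A) :=
  [set g | [/\ ran f `<=` dom g,
               ran g `<=` dom f,
               pcomp f (restr (ran f) g) = id_on (ran f) &
               ran (restr (ran f) g) = ran g]].

(** [X^*] is [seq X], and [X^n] is the set of strings of length [n]; in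
    particular an element of [X] is identified with a string of length one. *)
Section Strings.
Variables X Y : Type.
Implicit Types (F : seq X -> Y) (x y z : seq X).

Definition arity n F : seq X -> option Y :=
  restr [set x | size x = n] (fun x => Some (F x)).

Definition flat F : seq X -> option Y :=
  restr [set x | x <> [::]] (fun x => Some (F x)).

Definition standard F : Prop := forall x, F x = F [::] -> x = [::].

Definition preassociative F : Prop :=
  forall x y y' z, F y = F y' -> F (x ++ y ++ z) = F (x ++ y' ++ z).

Definition unarily_quasi_range_idempotent F : Prop :=
  ran (arity 1 F) = ran (flat F).

End Strings.

(** [X \cup {eps}] is the type [1.-bseq X] of strings of length at most one. *)
Section Operations.
Variable X : Type.
Implicit Types (H : seq X -> 1.-bseq X) (x y z : seq X).

Definition eps_standard H : Prop :=
  H [::] = [::] :> seq X /\ forall x, H x = [::] :> seq X -> x = [::].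

Definition str_associative H : Prop :=
  forall x y z, H (x ++ y ++ z) = H (x ++ H y ++ z).

Definition op_flat H : seq X -> option (seq X) :=
  flat (fun x => H x : seq X).

End Operations.

Definition factorization (X Y : Type) (F : seq X -> Y)
    (H : seq X -> 1.-bseq X) (f : seq X -> option Y) : Prop :=
  [/\ str_associative H /\ eps_standard H,
      dom f = ran (op_flat H),
      one_to_one f &
      flat F = pcomp f (op_flat H)].

(* Main.v *)
(** The key fact is that [F] agrees with [F \o H] on nonempty strings, because
    associativity makes [H] idempotent; hence [f] is a restriction of [F_1] and
    [ran F_1 = ran F^flat].  Since [f] is one-to-one, [F y = F y'] with [y], [y']
    nonempty means [H y = H y'], so associativity of [H] gives preassociativity
    of [F] on nonempty strings.  Conversely, [F_1 (g y) = y] on [ran F_1] for a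
    quasi-inverse [g], so preassociativity lets one replace a nonempty substring
    [y] by the letter [g (F y)]: this is the associativity of [g \o F^flat]. *)
Require Import Defs.
From mathcomp Require Import all_boot.
From mathcomp Require Import boolp classical_sets.

Set Implicit Arguments.
Unset Strict Implicit.
Unset Printing Implicit Defensive.

Lemma restrP (A B : Type) (D : set A) (f : A -> option B) x y :
  restr D f x = Some y <-> D x /\ f x = Some y.
Proof.
rewrite /restr; case: ifPn => [/set_mem Dx|/negP nDx].
  by split=> [|[]].
by split=> // -[Dx]; case: nDx; apply: mem_set.
Qed.

Lemma restr_in (A B : Type) (D : set A) (f : A -> option B) x :
  D x -> restr D f x = f x.
Proof. by move=> Dx; rewrite /restr mem_set. Qed.

Lemma restr_notin (A B : Type) (D : set A) (f : A -> option B) x :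
  ~ D x -> restr D f x = None.
Proof. by move=> nDx; rewrite /restr; case: ifPn => // /set_mem. Qed.

Lemma pinverse_Some (A B : Type) (f : A -> option B) y x :
  pinverse f y = Some x -> f x = Some y.
Proof.
by rewrite /pinverse; case: pselect => // ex [<-]; case: (cid ex).
Qed.

Lemma pinverse_total (A B : Type) (f : A -> option B) y :
  ran f y -> exists x, pinverse f y = Some x.
Proof. by rewrite /pinverse => fy; case: pselect => // ex; eexists. Qed.

(** A chosen preimage under [f] is also one under its extension [f0]. With [f] equal to [f0], choice
    yields a quasi-inverse; with [f] one-to-one, the quasi-inverse obtained is the inverse of
    [f]. *)
Lemma Q_pinverse (A B : Type) (f0 f : A -> option B) :
    (forall x y, f x = Some y -> f0 x = Some y) ->
    (ran f0 `<=` ran f)%classic ->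
  Q f0 (pinverse f).
Proof.
move=> ff0 ranf; split.
- by move=> y f0y; exact/pinverse_total/ranf.
- by move=> x [y gy]; exists y; apply/ff0/pinverse_Some.
- apply/funext => y; rewrite /pcomp /id_on.
  case: ifPn => [/set_mem f0y|/negP nf0y]; last first.
    by rewrite restr_notin // => /mem_set.
  have [x gx] := pinverse_total (ranf _ f0y).
  by rewrite restr_in // gx /=; apply/ff0/pinverse_Some.
- apply/seteqP; split => x [y].
    by move=> /restrP[_ gx]; exists y.
  move=> gx; exists y; apply/restrP; split=> //.
  by exists x; apply/ff0/pinverse_Some.
Qed.

Lemma flatP (X Y : Type) (F : seq X -> Y) x y :
  flat F x = Some y <-> x <> [::] /\ F x = y.
Proof.
rewrite /flat; split=> [/restrP[x0 [<-]] //|[x0 <-]].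
by apply/restrP.
Qed.

Lemma flatE (X Y : Type) (F : seq X -> Y) x :
  x <> [::] -> flat F x = Some (F x).
Proof. by move=> x0; apply/flatP. Qed.

Lemma flat_nil (X Y : Type) (F : seq X -> Y) : flat F [::] = None.
Proof. by apply: restr_notin => /=; apply. Qed.

Lemma arityP (X Y : Type) n (F : seq X -> Y) x y :
  arity n F x = Some y <-> size x = n /\ F x = y.
Proof.
rewrite /arity; split=> [/restrP[xn [<-]] //|[xn <-]].
by apply/restrP.
Qed.

Lemma size_eps_standard (X : Type) (H : seq X -> 1.-bseq X) x :
  eps_standard H -> x <> [::] -> size (H x) = 1.
Proof.
move=> [_ H0] x0; have := size_bseq (H x).
by case: (H x : seq X) (H0 x) => [/(_ erefl)|a [|b s]].
Qed.

Lemma size1_nonempty (X : Type) (x : seq X) : size x = 1 -> x <> [::].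
Proof. by case: x. Qed.

Lemma substitution_nonempty (X : Type) (x y z : seq X) :
  y <> [::] -> x ++ y ++ z <> [::].
Proof. by case: x y => [|a x] []. Qed.

(** A factorization says nothing about [F] at the empty string, so this weaker form of
    preassociativity is what it yields. *)
Definition flat_preassociative (X Y : Type) (F : seq X -> Y) : Prop :=
  forall x y y' z, y <> [::] -> y' <> [::] ->
    F y = F y' -> F (x ++ y ++ z) = F (x ++ y' ++ z).

Lemma factorizationE (X Y : Type) (F : seq X -> Y) H f x :
  factorization F H f -> x <> [::] -> f (H x) = Some (F x).
Proof.
move=> [_ _ _ /(congr1 (@^~ x))] + x0.
by rewrite /pcomp /op_flat !flatE.
Qed.

Lemma factorization_F_H (X Y : Type) (F : seq X -> Y) H f x :
  factorization F H f -> x <> [::] -> F (H x) = F x.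
Proof.
move=> FHf x0; have [[Ha Hs] _ _ _] := FHf.
have Hx0 := size1_nonempty (size_eps_standard Hs x0).
apply: Some_inj; rewrite -!(factorizationE FHf) //.
by have := Ha [::] x [::]; rewrite /= !cats0 => <-.
Qed.

Lemma factorization_restr (X Y : Type) (F : seq X -> Y) H f :
  factorization F H f -> f = restr (ran (op_flat H)) (arity 1 F).
Proof.
move=> FHf; have [[_ Hs] domf _ _] := FHf; apply/funext => h.
have [|nh] := pselect (ran (op_flat H) h).
  (* At [h = H x] both sides equal [F x]; outside [ran (op_flat H)] both are undefined. *)
  move=> hH; rewrite restr_in //; case: hH => x /flatP[x0 <-].
  rewrite (factorizationE FHf) //; apply/esym/arityP.
  by split; [exact: size_eps_standard|exact: factorization_F_H FHf x0].
rewrite restr_notin //; case fh: (f h) => [y|] //; case: nh.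
by rewrite -domf; exists y.
Qed.

Lemma factorization_ran (X Y : Type) (F : seq X -> Y) H f :
  factorization F H f -> unarily_quasi_range_idempotent F.
Proof.
move=> FHf; have [[_ Hs] _ _ _] := FHf; apply/seteqP; split=> y [x].
  by move=> /arityP[/size1_nonempty x0 <-]; exists x; exact: flatE.
move=> /flatP[x0 <-]; exists (H x); apply/arityP.
by split; [exact: size_eps_standard|exact: factorization_F_H FHf x0].
Qed.

Lemma factorization_flat_preassociative (X Y : Type) (F : seq X -> Y) H f :
  factorization F H f -> flat_preassociative F.
Proof.
move=> FHf x y y' z y0 y'0 Fyy'; have [[Ha _] domf finj _] := FHf.
have fdom u : u <> [::] -> (H u : seq X) \in dom f.
  by move=> u0; apply/mem_set; exists (F u); exact: factorizationE FHf u0.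
(* [f] takes the common value of [F y] and [F y'] at both [H y] and [H y'], so injectivity
   identifies them. *)
have HH : H y = H y' :> seq X.
  by apply: finj; rewrite ?fdom // !(factorizationE FHf) ?Fyy'.
apply: Some_inj.
rewrite -!(factorizationE FHf); try exact: substitution_nonempty.
by rewrite Ha HH -Ha.
Qed.

Lemma preassociative_flat (X Y : Type) (F : seq X -> Y) :
  preassociative F -> flat_preassociative F.
Proof. by move=> Fp x y y' z _ _; exact: Fp. Qed.

(** Standardness rules out [F y = F y'] with exactly one of the two strings empty; if both are empty
    there is nothing to replace. *)
Lemma flat_preassociative_standard (X Y : Type) (F : seq X -> Y) :
  standard F -> flat_preassociative F -> preassociative F.
Proof.
move=> Fs Fp x [|a y] [|b y'] z Fyy' //; last exact: Fp.
- by have := Fs _ (esym Fyy').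
- by have := Fs _ Fyy'.
Qed.

(** Quasi-range-idempotence puts [F x] in the range of [F_1], where [g] is a right inverse of [F_1];
    hence [g (F x)] lies in the domain of [F_1], the strings of length one. *)
Lemma quasi_inverse_size1 (X Y : Type) (F : seq X -> Y) g x :
    unarily_quasi_range_idempotent F -> Q (arity 1 F) g -> x <> [::] ->
  exists2 h, g (F x) = Some h & size h = 1 /\ F h = F x.
Proof.
move=> Fr [rg _ fg _] x0.
have Fx : ran (arity 1 F) (F x) by rewrite Fr; exists x; exact: flatE.
have [h gh] := rg _ Fx; exists h => //; apply/arityP.
have := congr1 (@^~ (F x)) fg.
by rewrite /pcomp /id_on restr_in // gh /= mem_set.
Qed.

Lemma quasi_inverse_operation (X Y : Type) (F : seq X -> Y) g :
    unarily_quasi_range_idempotent F -> Q (arity 1 F) g ->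
  exists H, eps_standard H /\ op_flat H = pcomp g (flat F).
Proof.
move=> Fr Qg.
(* The defaults of [odflt] and [insubd] are never reached: for nonempty [x], [g (F x)] is a string
   of length one. *)
pose H (x : seq X) : 1.-bseq X :=
  if x is [::] then [bseq] else insubd [bseq] (odflt [::] (g (F x))).
have HE x : x <> [::] -> g (F x) = Some (H x : seq X) /\ size (H x) = 1.
  move=> x0; have [h gh [h1 _]] := quasi_inverse_size1 Fr Qg x0.
  have -> : H x = insubd [bseq] h by rewrite /H gh; case: x x0 {gh}.
  by rewrite val_insubd h1.
exists H; split.
  split=> // x Hx; have [//|/HE[_]] := pselect (x = [::]).
  by rewrite Hx.
apply/funext => x; rewrite /pcomp /op_flat.
have [->|x0] := pselect (x = [::]); first by rewrite !flat_nil.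
by rewrite !flatE //= (HE _ x0).1.
Qed.

Lemma quasi_inverse_factorization (X Y : Type) (F : seq X -> Y) g H :
    flat_preassociative F -> unarily_quasi_range_idempotent F ->
    Q (arity 1 F) g -> eps_standard H -> op_flat H = pcomp g (flat F) ->
  factorization F H (restr (ran (op_flat H)) (arity 1 F)).
Proof.
move=> Fp Fr Qg Hs Hg.
have gF x : x <> [::] -> g (F x) = Some (H x : seq X).
  move=> x0; have := congr1 (@^~ x) Hg.
  by rewrite /pcomp /op_flat !flatE.
have HE x : x <> [::] -> size (H x) = 1 /\ F (H x) = F x.
  move=> x0; have [h] := quasi_inverse_size1 Fr Qg x0.
  by rewrite gF // => -[<-].
have HF x : x <> [::] -> arity 1 F (H x) = Some (F x).
  by move=> /HE Hx; apply/arityP.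
have ranH x : x <> [::] -> ran (op_flat H) (H x).
  by move=> x0; exists x; exact: flatE.
split.
- split=> // x y z.
  have [->|y0] := pselect (y = [::]); first by rewrite Hs.1.
  have [Hy1 FHy] := HE _ y0; have Hy0 := size1_nonempty Hy1.
  (* Both sides become values of [g] after [F], and [F (H y) = F y] lets preassociativity exchange
     [y] and [H y]. *)
  apply/val_inj/Some_inj; rewrite -!gF; try exact: substitution_nonempty.
  by congr g; exact: Fp.
- apply/seteqP; split=> h; first by move=> [y /restrP[]].
  move=> hH; have [x /flatP[x0 Hx]] := hH; exists (F x).
  by rewrite restr_in // -Hx HF.
- move=> h h' /set_mem[y /restrP[[x /flatP[x0 <-]] _]].
  move=> /set_mem[y' /restrP[[x' /flatP[x'0 <-]] _]].
  rewrite !restr_in; [|exact: ranH|exact: ranH].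
  (* Equal values of [F_1] at [H x] and [H x'] mean [F x = F x']; applying [g] recovers
     [H x = H x']. *)
  by rewrite !HF // => -[Fxx']; apply: Some_inj; rewrite -!gF // Fxx'.
- apply/funext => x; rewrite /pcomp.
  have [->|x0] := pselect (x = [::]); first by rewrite /op_flat !flat_nil.
  rewrite /op_flat !flatE //= restr_in; first by rewrite HF.
  exact: ranH.
Qed.

Unset Implicit Arguments.
Set Strict Implicit.

Theorem theorem4p9 (X Y : Type) (F : seq X -> Y) :
  inhabited X -> inhabited Y ->
  [/\ (* (i) implies (ii) *)
      preassociative F /\ unarily_quasi_range_idempotent F ->
        (exists H f, factorization F H f),
      (* (ii) implies (i) when F is standard *)
      standard F -> (exists H f, factorization F H f) ->
        preassociative F /\ unarily_quasi_range_idempotent F,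
      (* consequences for any H, f as in (ii) *)
      forall H f, factorization F H f ->
        [/\ flat F = pcomp (arity 1 F) (op_flat H),
            f = restr (ran (op_flat H)) (arity 1 F) &
            Q (arity 1 F) (pinverse f)] &
      (* if (ii) holds, any g in Q(F_1) yields an H as in (ii) *)
      (exists H f, factorization F H f) ->
        forall g, Q (arity 1 F) g ->
          (exists H, eps_standard H /\ op_flat H = pcomp g (flat F)) /\
          (forall H, eps_standard H -> op_flat H = pcomp g (flat F) ->
             exists f, factorization F H f)].
Proof.
move=> _ _; split.
- move=> [/preassociative_flat Fp Fr].
  have Qg : Q (arity 1 F) (pinverse (arity 1 F)) by exact: Q_pinverse.
  have [H [Hs Hg]] := quasi_inverse_operation Fr Qg.
  by eexists; eexists; exact: quasi_inverse_factorization Hg.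
- move=> Fs [H [f FHf]]; split; last exact: factorization_ran FHf.
  apply: flat_preassociative_standard => //.
  exact: factorization_flat_preassociative FHf.
- move=> H f FHf; have fE := factorization_restr FHf.
  have [_ _ _ FfH] := FHf; split=> //.
  + apply/funext => x; rewrite FfH /pcomp.
    case Hx: (op_flat H x) => [h|] //=.
    by rewrite fE restr_in //; exists x.
  (* [f] is a restriction of [F_1] that still attains its whole range, since [f (H x) = F x]. *)
  + apply: Q_pinverse => [x y|y]; first by rewrite {1}fE => /restrP[].
    rewrite (factorization_ran FHf) => -[x /flatP[x0 <-]].
    by exists (H x); exact: factorizationE FHf x0.
- move=> [H0 [f0 FHf]] g Qg; have Fr := factorization_ran FHf; split.
    exact: quasi_inverse_operation.
  (* The given factorization by [H0] and [f0] supplies the preassociativity on nonempty strings used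
     to factor through the new [H]. *)
  move=> H Hs Hg; eexists; apply: quasi_inverse_factorization Hg => //.
  exact: factorization_flat_preassociative FHf.
Qed.
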